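(* For every integer $n \ge 2$, we have $$ \frac{\tau(n)^{2}}{4}(\log n)\Bigl(1+O\Bigl(\frac{1}{\log n}+\frac{1}{\sqrt{\Omega_{2}(n)}}\Bigr)\Bigr) \le \log V(n) \le \frac{3\tau(n)^{2}}{8}(\log n), $$ where the implied constant in the $O$-term is absolute. That is, the upper bound holds for every integer $n\ge 2$, and there is an absolute constant $C>0$ such that for every integer $n \ge 2$, $$ \log V(n) \ge \frac{\tau(n)^{2}}{4}(\log n)\Bigl(1-C\Bigl(\frac{1}{\log n}+\frac{1}{\sqrt{\Omega_{2}(n)}}\Bigr)\Bigr). $$
   Context: For an integer $n\ge 1$, $\tau(n)$ denotes the number of positive divisors of $n$, and $1=d_1<d_2<\cdots<d_{\tau(n)}=n$ denotes the ordered sequence of the positive divisors of $n$. The function $V$ is the Vandermonde determinant of the divisors: $$V(n):=\prod_{1\le i<j\le \tau(n)}(d_j-d_i)\quad (n\ge 1).$$ The function $\Omega_2$ is defined by $$\Omega_2(n):=\sum_{p^\alpha\| n}\alpha^2\quad (n\ge 1),$$ where the sum runs over the primes $p$ dividing $n$ and $p^\alpha\|n$ means that $p^\alpha$ is the exact power of $p$ dividing $n$ (so $\alpha\ge 1$). $\log$ is the natural logarithm. *)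

(* Defs.v *)
From HB Require Import structures.
From mathcomp Require Import all_boot all_order all_algebra.
From mathcomp Require Import all_classical all_reals all_analysis.

Set Implicit Arguments.
Unset Strict Implicit.
Unset Printing Implicit Defensive.

Import Order.TTheory GRing.Theory Num.Theory.

Local Open Scope ring_scope.

Definition tau (n : nat) : nat := size (divisors n).

(* [divisors n] is sorted increasingly, so the divisor d_(i+1) of the usual
   1-based numbering is the entry of index i.  The differences are taken in
   [int], where subtraction is not truncated. *)
Definition vandermonde_divisors (n : nat) : int :=
  \prod_(j < tau n) \prod_(i < tau n | (i < j)%N)
    ((nth 0%N (divisors n) j)%:Z - (nth 0%N (divisors n) i)%:Z).

Definition Omega2 (n : nat) : nat := (\sum_(p <- primes n) logn p n ^ 2)%N.

(* Main.v *)
Require Import Defs.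
From HB Require Import structures.
From mathcomp Require Import all_boot all_order all_algebra.
From mathcomp Require Import all_classical all_reals all_analysis.
From mathcomp Require Import zify ring lra.

(* Write 2 log V(n) as the sum of log |d - d'| over ordered pairs of divisors.

   Upper bound: log |d - d'| <= log max(d, d'), that is, half of
   log d + log d' + |log d - log d'|.  The involution d' -> n / d' and the
   inequality |x - y| + |x - (L - y)| <= L on [0, L] bound the average of the
   last term by L / 2, where L = log n.

   Lower bound: log |d - d'| >= (log d + log d') / 2 - log 2 unless d and d' are
   within a factor 2 of each other, where only log |d - d'| >= 0 is used and L
   is lost.  So it is enough that every dyadic interval [y, 2y) contains
   O(tau(n) / sqrt(Omega_2(n))) divisors.  Those divisors form an antichain for
   divisibility, and Kleitman's induction on the primes bounds their number by
   the largest rank number of the divisor lattice, that is, the largest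
   coefficient of prod_p (1 + X + ... + X^(alpha_p)).  These coefficients are
   log-concave, which forces the largest one, M, to satisfy
   M ^ 2 * variance = O(tau(n) ^ 2); and the variance is
   sum_p alpha_p (alpha_p + 2) / 12. *)

Import Order.TTheory GRing.Theory Num.Theory.

Local Open Scope ring_scope.

(** * Sums over boxes and log-concavity *)

(** The sample points step by 2 from [k + e] down to [k - e], so the box is symmetric about [k]
    without half-integers when [e] is odd. *)
Definition boxsum (e : nat) (f : int -> int) (k : int) : int :=
  \sum_(i < e.+1) f (k + e%:Z - (2 * i)%:Z).

(* [smear s f k] is the sum of [f (k + S)] over all integer vectors [v] with
   [0 <= v_i <= s_i], where [S = sum_i (s_i - 2 v_i)].  For [s] the exponents
   of [n], it is a sum over the divisors [d] of [n], with [S] the number of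
   prime factors of [n / d] minus that of [d], counted with multiplicity. *)
Definition smear (s : seq nat) (f : int -> int) : int -> int :=
  foldr boxsum f s.

Lemma smear_cons (e : nat) (s : seq nat) (f : int -> int) (k : int) :
  smear (e :: s) f k = \sum_(i < e.+1) smear s f (k + e%:Z - (2 * i)%:Z).
Proof. by []. Qed.

Lemma smear_sum (s : seq nat) (I : Type) (r : seq I) (P : pred I)
    (f : I -> int -> int) (k : int) :
  smear s (fun x => \sum_(j <- r | P j) f j x) k
  = \sum_(j <- r | P j) smear s (f j) k.
Proof.
elim: s k => [//|e s IHs] k /=.
by rewrite /boxsum [RHS]exchange_big; apply: eq_bigr => i _; exact: IHs.
Qed.

Lemma smear_shift (s : seq nat) (f : int -> int) (c k : int) :
  smear s (fun x => f (x + c)) k = smear s f (k + c).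
Proof.
elim: s k => [//|e s IHs] k /=.
by apply: eq_bigr => i _; rewrite IHs; congr (smear s f _); lia.
Qed.

Lemma eq_smear (s : seq nat) (f g : int -> int) :
  f =1 g -> smear s f =1 smear s g.
Proof.
by move=> fg; elim: s => [//|e s IHs] k /=; apply: eq_bigr => i _; exact: IHs.
Qed.

Lemma smearZ (s : seq nat) (c : int) (f : int -> int) (k : int) :
  smear s (fun x => c * f x) k = c * smear s f k.
Proof.
elim: s k => [//|e s IHs] k /=.
by rewrite /boxsum mulr_sumr; apply: eq_bigr => i _; exact: IHs.
Qed.

Lemma smearN (s : seq nat) (f : int -> int) (k : int) :
  smear s (fun x => - f x) k = - smear s f k.
Proof.
by rewrite -mulN1r -smearZ; apply: eq_smear => x; rewrite mulN1r.
Qed.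

Lemma smearD (s : seq nat) (f g : int -> int) (k : int) :
  smear s (fun x => f x + g x) k = smear s f k + smear s g k.
Proof.
elim: s k => [//|e s IHs] k /=.
by rewrite -big_split; apply: eq_bigr => i _; exact: IHs.
Qed.

Lemma le_smear (s : seq nat) (f g : int -> int) (k : int) :
  (forall x, `|x - k| <= (sumn s)%:Z -> f x <= g x) ->
  smear s f k <= smear s g k.
Proof.
elim: s k => [|e s IHs] k /= fg; first by apply: fg; lia.
apply: ler_sum => i _; apply: IHs => x xk; apply: fg.
by have := ltn_ord i; lia.
Qed.

Lemma smear_odd (s : seq nat) (f : int -> int) :
  (forall x, f (- x) = - f x) -> forall k, smear s f (- k) = - smear s f k.
Proof.
move=> fN; elim: s => [//|e s IHs] k /=.
rewrite /boxsum -sumrN (reindex_inj rev_ord_inj) /=.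
apply: eq_bigr => i _; rewrite -IHs; congr (smear s f _).
by have := ltn_ord i; lia.
Qed.

Lemma smear1 (s : seq nat) (k : int) :
  smear s (fun=> 1) k = (\prod_(e <- s) e.+1)%N%:Z.
Proof.
elim: s k => [|e s IHs] k; first by rewrite big_nil.
rewrite big_cons smear_cons; under [LHS]eq_bigr do rewrite IHs.
by rewrite sumr_const card_ord -mulr_natl natz PoszM.
Qed.

(** Cross terms cancel by symmetry, and the mean of (e - 2i)^2 over 0 <= i <= e is e(e + 2)/3; the
    factor 3 clears the denominator. *)
Lemma smear_sqr (s : seq nat) (k : int) :
  3 * smear s (fun x => x ^+ 2) k
  = (\prod_(e <- s) e.+1)%N%:Z * (3 * k ^+ 2 + (\sum_(e <- s) e * (e + 2))%N%:Z).
Proof.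
elim: s k => [|e s IHs] k; first by rewrite !big_nil /=; ring.
rewrite !big_cons smear_cons mulr_sumr.
under [LHS]eq_bigr do rewrite IHs.
rewrite -mulr_sumr big_split sumr_const card_ord /=.
suff -> : \sum_(i < e.+1) 3 * (k + e%:Z - (2 * i)%:Z) ^+ 2
    = e.+1%:Z * (3 * k ^+ 2 + (e * (e + 2))%:Z).
  by rewrite -[_ *+ _]mulr_natl natz !PoszM !PoszD; ring.
have gen (c : int) m : \sum_(i < m) 3 * (c - (2 * i)%:Z) ^+ 2
    = m%:Z * (3 * c ^+ 2 - 6 * c * (m%:Z - 1) + 2 * (m%:Z - 1) * (2 * m%:Z - 1)).
  elim: m => [|m IHm]; first by rewrite big_ord0 mul0r.
  have -> : m.+1%:Z = m%:Z + 1 by lia.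
  rewrite big_ord_recr /= IHm; have -> : (2 * m)%:Z = 2 * m%:Z by lia.
  by ring.
have -> : (e * (e + 2))%:Z = e%:Z * (e%:Z + 2) by lia.
rewrite gen; have -> : e.+1%:Z = e%:Z + 1 by lia.
by ring.
Qed.

(** * Log-concavity of the rank numbers *)

Definition logconcave (x : int -> int) : Prop :=
  forall (a : int) (s t : nat),
    x a * x (a + s%:Z + t%:Z) <= x (a + s%:Z) * x (a + t%:Z).

(** Moving the window by one gains one term and loses one. So [P i * P (j + 1) <= P (i + 1) * P j]
    splits into one inequality per end, each proved term by term; iterating it gives arbitrary gaps.
    On generating functions, this is multiplication by 1 + X + ... + X^(b-1). *)
Lemma logconcave_window (x : int -> int) (b : nat) :
  logconcave x -> logconcave (fun k => \sum_(i < b) x (k - i%:Z)).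
Proof.
move=> xlc; set P := (fun k => _).
have xlc' (a c d : int) : a <= c -> a <= d -> x a * x (c + d - a) <= x c * x d.
  move=> ac ad; have := xlc a `|c - a|%N `|d - a|%N.
  have -> : a + `|c - a|%N%:Z = c by lia.
  have -> : a + `|d - a|%N%:Z = d by lia.
  by have -> : c + `|d - a|%N%:Z = c + d - a by lia.
have PS (k : int) : P (k + 1) = P k + x (k + 1) - x (k + 1 - b%:Z).
  rewrite /P; have -> : \sum_(i < b) x (k + 1 - i%:Z)
      = \sum_(i < b.+1) x (k + 1 - i%:Z) - x (k + 1 - b%:Z).
    by rewrite big_ord_recr /= addrK.
  rewrite big_ord_recl /= subr0 [x _ + _]addrC; congr (_ + _ - _).
  by apply: eq_bigr => i _; congr (x _); rewrite /bump /=; lia.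
have step (i j : int) : i <= j -> P i * P (j + 1) <= P (i + 1) * P j.
  move=> ij.
  have H1 : x (j + 1) * P (i + 1) <= x (i + 1) * P (j + 1).
    rewrite /P !mulr_sumr; apply: ler_sum => l _.
    have := xlc' (i + 1 - l%:Z) (i + 1) (j + 1 - l%:Z).
    have -> : i + 1 + (j + 1 - l%:Z) - (i + 1 - l%:Z) = j + 1 by lia.
    by rewrite [x (j + 1) * _]mulrC; apply; lia.
  have H2 : x (i + 1 - b%:Z) * P (j + 1) <= x (j + 1 - b%:Z) * P (i + 1).
    rewrite /P !mulr_sumr; apply: ler_sum => l _.
    have lb := ltn_ord l.
    have := xlc' (i + 1 - b%:Z) (j + 1 - b%:Z) (i + 1 - l%:Z).
    have -> : j + 1 - b%:Z + (i + 1 - l%:Z) - (i + 1 - b%:Z) = j + 1 - l%:Z by lia.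
    by apply; lia.
  have -> : P i = P (i + 1) - x (i + 1) + x (i + 1 - b%:Z) by rewrite PS; ring.
  have -> : P j = P (j + 1) - x (j + 1) + x (j + 1 - b%:Z) by rewrite PS; ring.
  by rewrite -subr_ge0; move: H1 H2; rewrite -subr_ge0 -[_ <= x _ * P (i + 1)]subr_ge0; lia.
have wlg (a : int) (s t : nat) : (s <= t)%N ->
    P a * P (a + s%:Z + t%:Z) <= P (a + s%:Z) * P (a + t%:Z).
  elim: s a t => [|s IHs] a t st; first by rewrite !addr0.
  have /IHs H : (s <= t.-1)%N by lia.
  apply: le_trans (_ : P (a + 1) * P (a + s%:Z + t%:Z) <= _).
    have := step a (a + s%:Z + t%:Z).
    have -> : a + s%:Z + t%:Z + 1 = a + s.+1%:Z + t%:Z by lia.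
    by apply; lia.
  have := H (a + 1).
  have -> : a + 1 + s%:Z + t.-1%:Z = a + s%:Z + t%:Z by lia.
  have -> : a + 1 + s%:Z = a + s.+1%:Z by lia.
  by have -> : a + 1 + t.-1%:Z = a + t%:Z by lia.
move=> a s t; have [/wlg //|/ltnW /wlg H] := leqP s t.
by rewrite -addrA [s%:Z + _]addrC addrA [leRHS]mulrC.
Qed.

(* Two adjacent support points are used because [S] has the parity of [sumn s]:
   for either parity, [smear s unit_pulse 0] is the largest rank number. *)
Definition unit_pulse (x : int) : int := ((x == 0) || (x == -1))%:Z.

(** The forward difference of the sign function is 1 at -1 and 0, and vanishes elsewhere. *)
Lemma smear_sgz_pulse (s : seq nat) (k : int) :
  smear s (@sgz int) (k + 1) - smear s (@sgz int) k = smear s unit_pulse k.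
Proof.
rewrite -smear_shift -smearN -smearD; apply: eq_smear => x.
have sgzI (y : int) : sgz y = (0 < y)%R%:Z - (y < 0)%R%:Z.
  by rewrite /sgz; case: (ltgtP y 0).
rewrite !sgzI /unit_pulse.
by do 4 case: ltP => ?; case: (x =P 0) => ?; case: (x =P -1) => ? /=; lia.
Qed.

Lemma smear_sgz0 (s : seq nat) : smear s (@sgz int) 0 = 0.
Proof.
have : smear s (@sgz int) 0 = - smear s (@sgz int) 0.
  by rewrite -smear_odd ?oppr0 //; exact: sgzN.
by move: (smear s _ 0) => w; lia.
Qed.

Lemma smear_sgz1 (s : seq nat) : smear s (@sgz int) 1 = smear s unit_pulse 0.
Proof. by have := smear_sgz_pulse s 0; rewrite add0r smear_sgz0 subr0. Qed.

(** Along a residue class modulo 2 the pulse is a single point mass and [boxsum] is a window sum.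
    The offset [c] varies because each box shifts the class by [e]. *)
Lemma smear_pulse_logconcave (s : seq nat) (c : int) :
  logconcave (fun j => smear s unit_pulse (c + 2 * j)).
Proof.
elim: s c => [|e s IHs] c /=.
  by move=> a u v /=; rewrite /unit_pulse; lia.
have H := logconcave_window _ e.+1 (IHs (c + e%:Z)).
move=> a u v; move: (H a u v); rewrite /boxsum.
have E k : \sum_(i < e.+1) smear s unit_pulse (c + e%:Z + 2 * (k - i%:Z))
   = \sum_(i < e.+1) smear s unit_pulse (c + 2 * k + e%:Z - (2 * i)%:Z).
  by apply: eq_bigr => i _; congr (smear _ _ _); lia.
by rewrite !E.
Qed.

Lemma smear_pulse_ge0 (s : seq nat) (k : int) : 0 <= smear s unit_pulse k.
Proof.
elim: s k => [|e s IHs] k; first by rewrite /unit_pulse /=; lia.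
by rewrite smear_cons; apply: sumr_ge0 => i _; exact: IHs.
Qed.

Lemma sum_smear_pulse_le (s : seq nat) (N : nat) (u : nat -> int) :
  (forall x, \sum_(j < N) unit_pulse (x + u j) <= 1) ->
  \sum_(j < N) smear s unit_pulse (u j) <= (\prod_(e <- s) e.+1)%N%:Z.
Proof.
move=> u1; rewrite -(smear1 s 0).
under eq_bigr do rewrite -[u _]add0r -smear_shift.
(* Smearing is linear and monotone, so the disjoint pulses are dominated by the constant 1. *)
by rewrite -smear_sum; apply: le_smear => x _; exact: u1.
Qed.

Lemma sum_pulse_le1 (N : nat) (x : int) :
  \sum_(j < N) unit_pulse (x + (2 * j)%:Z) <= 1.
Proof.
have [x0|x0] := leP x 0; last first.
  by rewrite big1 // => j _; rewrite /unit_pulse; lia.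
elim: N => [|N IHN]; first by rewrite big_ord0.
rewrite big_ord_recr /=; have [e|ne] := eqVneq (unit_pulse (x + (2 * N)%:Z)) 0.
  by rewrite e addr0.
rewrite big1 ?add0r /unit_pulse; first by lia.
by move=> j _; move: ne (ltn_ord j); rewrite /unit_pulse; lia.
Qed.

Lemma sum_pulseN_le1 (N : nat) (x : int) :
  \sum_(j < N) unit_pulse (x - (2 * j)%:Z) <= 1.
Proof.
under eq_bigr => j _.
  have -> : unit_pulse (x - (2 * j)%:Z) = unit_pulse (- x - 1 + (2 * j)%:Z).
    by rewrite /unit_pulse; lia.
over.
exact: sum_pulse_le1.
Qed.

(* The hypothesis on products gives
   [h 0 ^+ 2 * h (a + b + c) <= h a * h b * h c]; a second moment bound for a
   log-concave sequence in terms of its value at [0] follows, because the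
   number of triples with [a + b + c = j] is quadratic in [j]. *)
Lemma cube_sum_le (N : nat) (h : nat -> int) (M : int) :
  (forall j, 0 <= h j) -> (forall a b, h 0 * h (a + b)%N <= h a * h b) ->
  \sum_(j < N) h j <= M ->
  h 0 ^+ 2 * \sum_(a < N) \sum_(b < N) \sum_(c < N) h (a + b + c)%N <= M ^+ 3.
Proof.
move=> h0 hh hM; set S := \sum_(j < N) h j in hM *.
have S0 : 0 <= S by apply: sumr_ge0 => j _; exact: h0.
apply: (@le_trans _ _ (S ^+ 3)); last by rewrite lerXn2r // nnegrE ?(le_trans S0).
have -> : S ^+ 3 = \sum_(a < N) \sum_(b < N) \sum_(c < N) h a * h b * h c.
  rewrite exprS expr2 /S mulr_suml; apply: eq_bigr => a _.
  rewrite mulr_suml mulr_sumr; apply: eq_bigr => b _.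
  by rewrite !mulr_sumr; apply: eq_bigr => c _; rewrite mulrA.
do 3 (rewrite mulr_sumr; apply: ler_sum => ? _).
rewrite expr2 -mulrA; apply: le_trans (ler_wpM2l (h0 0) (hh _ _)) _.
by rewrite mulrA ler_wpM2r.
Qed.

Lemma double_sum_ge (N : nat) (w F : nat -> int) :
  (forall j, 0 <= w j) -> (forall j, 0 <= F j) ->
  \sum_(j < N) (\sum_(b < j.+1) w b) * F j
  <= \sum_(a < N) \sum_(b < N) w b * F (a + b)%N.
Proof.
move=> w0 F0; rewrite [leRHS]exchange_big /=.
have -> : \sum_(j < N) (\sum_(b < j.+1) w b) * F j
    = \sum_(b < N) \sum_(b <= j < N) w b * F j.
  under [RHS]eq_bigr do rewrite big_geq_mkord.
  rewrite (exchange_big_dep xpredT) //=; apply: eq_bigr => j _.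
  have /= <- := big_ord_widen N (fun b => w b * F j) (ltn_ord j).
  by rewrite mulr_suml.
apply: ler_sum => b _; rewrite -{1}[val b]add0n big_addn big_mkord.
rewrite (big_ord_widen N (fun a => w b * F (a + b)%N)) ?leq_subr //.
by rewrite [leRHS](bigID (fun a : 'I_N => (a < N - b)%N)) /= lerDl;
  apply: sumr_ge0 => a _; rewrite mulr_ge0.
Qed.

(** For j < N, (j + 1)(j + 2)/2 triples have sum j, and (2j + 1)^2 <= 4(j + 1)(j + 2). The count
    comes from [double_sum_ge] used with weights 1 and then b + 1. *)
Lemma triple_sum_ge (N : nat) (F : nat -> int) :
  (forall j, 0 <= F j) ->
  \sum_(j < N) ((2 * j + 1) ^ 2)%N%:Z * F j
  <= 8 * \sum_(a < N) \sum_(b < N) \sum_(c < N) F (a + b + c)%N.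
Proof.
move=> F0.
have sum_succ j : 2 * \sum_(b < j) b.+1%:Z = (j * (j + 1))%N%:Z.
  by elim: j => [|j IHj]; rewrite ?big_ord0 // big_ord_recr /= mulrDr IHj; lia.
have dbl a : \sum_(j < N) j.+1%:Z * F (a + j)%N
    <= \sum_(b < N) \sum_(c < N) F (a + b + c)%N.
  apply: le_trans (le_trans (double_sum_ge N (fun=> 1) (fun j => F (a + j)%N) _ _) _) => //.
    by apply: ler_sum => j _; rewrite sumr_const card_ord -[1 *+ _]mulr_natl natz mulr1.
  by apply: ler_sum => b _; apply: ler_sum => c _; rewrite mul1r addnA.
apply: le_trans (_ : 8 * \sum_(j < N) (\sum_(b < j.+1) b.+1%:Z) * F j <= _).
  rewrite mulr_sumr; apply: ler_sum => j _; rewrite mulrA ler_wpM2r //.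
  by have := sum_succ j.+1; lia.
rewrite ler_pM2l //; apply: le_trans (double_sum_ge N (fun b => b.+1%:Z) F _ F0) _ => //.
by apply: ler_sum => a _; exact: dbl.
Qed.

(** Some pulse with j about |x|/2 is 1 at x, and there |x| <= 2j + 1. *)
Lemma sqr_le_pulses (N : nat) (x : int) : `|x| < N%:Z ->
  x ^+ 2 <= \sum_(j < N) ((2 * j + 1) ^ 2)%N%:Z
              * (unit_pulse (x + (2 * j)%:Z) + unit_pulse (x - (2 * j)%:Z)).
Proof.
move=> xN; have [j jN xj] : exists2 j : nat, (j < N)%N &
    [\/ x + (2 * j)%:Z = 0, x + (2 * j)%:Z = -1,
        x - (2 * j)%:Z = 0 | x - (2 * j)%:Z = -1].
  exists (`|x|%N./2 + (odd `|x|%N && (0 < x)%R))%N; first by lia.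
  have := odd_double_half `|x|%N.
  by have [x0|x0] := leP x 0; case: (odd _) => /= ?;
    [constructor 2|constructor 1|constructor 4|constructor 3]; lia.
rewrite (bigD1 (Ordinal jN)) //=; apply: ler_wpDr.
  by apply: sumr_ge0 => i _; rewrite /unit_pulse; lia.
have : 1 <= unit_pulse (x + (2 * j)%:Z) + unit_pulse (x - (2 * j)%:Z).
  by rewrite /unit_pulse; case: xj => ->; lia.
move: (_ + unit_pulse _) => u u1; have xj2 : `|x| <= (2 * j + 1)%N%:Z by case: xj; lia.
nia.
Qed.

(* Compare the exact second moment of [S] with the bound on it that
   log-concavity imposes on either side of [0]. *)
Lemma smear_pulse_le (s : seq nat) :
  smear s unit_pulse 0 ^+ 2 * (\sum_(e <- s) e ^ 2)%N%:Z
  <= 48 * (\prod_(e <- s) e.+1)%N%:Z ^+ 2.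
Proof.
set g := smear s unit_pulse; set T : int := (\prod_(e <- s) e.+1)%N.
set V := (\sum_(e <- s) e ^ 2)%N.
set N := (sumn s).+1; pose gp j := g (2 * j)%N%:Z; pose gn j := g (- (2 * j)%N%:Z).
have T0 : 0 < T by rewrite ltz_nat prodn_gt0.
have var : T * V%:Z <= 3 * \sum_(j < N) ((2 * j + 1) ^ 2)%N%:Z * (gp j + gn j).
  have VE : (V <= \sum_(e <- s) e * (e + 2))%N.
    by apply: leq_sum => e _; rewrite expnS expn1 leq_mul // leq_addr.
  have := smear_sqr s 0; rewrite expr0n mulr0 add0r => E.
  apply: le_trans (_ : 3 * smear s (fun x => x ^+ 2) 0 <= _).
    by rewrite E ler_pM2l // lez_nat.
  rewrite ler_pM2l //; pose t j := ((2 * j + 1) ^ 2)%N%:Z.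
  apply: le_trans (le_smear s _ _ 0 (fun x xN => sqr_le_pulses N x _)) _; first by lia.
  rewrite smear_sum; apply: ler_sum => j _.
  rewrite smearZ smearD smear_shift add0r.
  by rewrite (smear_shift s unit_pulse (- _)) add0r.
have gbound h : (forall j, 0 <= h j) -> (forall a b, h 0 * h (a + b)%N <= h a * h b) ->
    \sum_(j < N) h j <= T -> h 0 ^+ 2 * \sum_(j < N) ((2 * j + 1) ^ 2)%N%:Z * h j
    <= 8 * T ^+ 3.
  move=> h0 hh hT.
  apply: le_trans (ler_wpM2l (sqr_ge0 _) (triple_sum_ge N h h0)) _.
  by rewrite mulrCA ler_pM2l //; exact: cube_sum_le.
have Bp : g 0 ^+ 2 * \sum_(j < N) ((2 * j + 1) ^ 2)%N%:Z * gp j <= 8 * T ^+ 3.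
  apply: (gbound gp) => [j|a b|]; first exact: smear_pulse_ge0.
    have /= := smear_pulse_logconcave s 0 0 a b.
    by rewrite !add0r mulr0 -PoszD.
  by apply: (sum_smear_pulse_le s N (fun j => (2 * j)%N%:Z)) => x; exact: sum_pulse_le1.
have Bn : g 0 ^+ 2 * \sum_(j < N) ((2 * j + 1) ^ 2)%N%:Z * gn j <= 8 * T ^+ 3.
  apply: (gbound gn) => [j|a b|]; first exact: smear_pulse_ge0.
    have /= := smear_pulse_logconcave s 0 (- (a + b)%:Z) a b.
    rewrite /gn !add0r -/g.
    have -> : - (a + b)%:Z + a%:Z + b%:Z = 0 by lia.
    have -> : - (a + b)%:Z + a%:Z = - b%:Z by lia.
    have -> : - (a + b)%:Z + b%:Z = - a%:Z by lia.
    by rewrite mulr0 oppr0 !PoszM !mulrN mulrC [leRHS]mulrC.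
  by apply: (sum_smear_pulse_le s N (fun j => - (2 * j)%N%:Z)) => x; exact: sum_pulseN_le1.
(* The 48 is the 3 of the second moment times 8 for each side of 0. *)
have B : g 0 ^+ 2 * (T * V%:Z) <= T * (48 * T ^+ 2).
  apply: le_trans (ler_wpM2l (sqr_ge0 _) var) _.
  under eq_bigr do rewrite mulrDr.
  rewrite big_split /= mulrCA mulrDr.
  have -> : T * (48 * T ^+ 2) = 3 * (8 * T ^+ 3 + 8 * T ^+ 3) by ring.
  by rewrite ler_pM2l // lerD.
by move: B; rewrite mulrCA ler_pM2l.
Qed.

(** * Divisors in dyadic intervals *)

Lemma sum_add_divisors (V : nmodType) (p e : nat) (ds : seq nat) (F : nat -> V) :
  \sum_(d <- PrimeDecompAux.add_divisors (p, e) ds) F d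
  = \sum_(i < e.+1) \sum_(d <- ds) F (p ^ i * d)%N.
Proof.
rewrite /PrimeDecompAux.add_divisors; elim: e F => [|e IHe] F.
  by rewrite big_ord1 /=; apply: eq_bigr => d _; rewrite mul1n.
rewrite /= (perm_big _ (permEl (perm_merge _ _ _))) big_cat big_map IHe.
rewrite [RHS]big_ord_recl [LHS]addrC; congr (_ + _).
  by apply: eq_bigr => d _; rewrite mul1n.
apply: eq_bigr => i _; apply: eq_bigr => d _.
by rewrite NatTrec.mulE mulnA expnS.
Qed.

(** The endpoint is rational because the induction on the primes divides it by powers of p. *)
Definition dyadic_count (ds : seq nat) (y : rat) : int :=
  \sum_(d <- ds) ((y <= d%:R) && (d%:R < 2 * y) : nat)%:Z.

(** A path for this relation lists the left endpoints of pairwise disjoint intervals [y, 2y). *)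
Definition doubling : rel rat := fun y z => (0 < y) && (2 * y <= z).

Lemma doubling_trans : transitive doubling.
Proof.
by move=> y x z /andP[x0 xy] /andP[y0 yz]; apply/andP; split=> //; lra.
Qed.

(* Replacing [z] by the geometric progression from [z / p ^ m] up to [z] keeps
   the doubling property: this is one hook in the peeling of the rectangular
   array [u / p ^ i], for [u] in [z :: y] and [i <= m]. *)
Lemma hook (D : rat -> int) (p m : nat) (z : rat) (y : seq rat) :
  (1 < p)%N -> 0 < z -> path doubling z y ->
  exists2 t, path doubling (z / p%:R ^+ m) t /\ (size t = m + size y)%N &
    \sum_(u <- z / p%:R ^+ m :: t) D u
    = \sum_(i < m.+1) D (z / p%:R ^+ i) + \sum_(u <- y) D u.
Proof.
move=> p1 z0 zy; elim: m => [|m [t [pt st] E]].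
  by exists y; rewrite ?expr0 ?divr1 // big_cons big_ord1 expr0 divr1.
have p2 : 2 <= p%:R :> rat by rewrite (ler_nat _ 2).
exists (z / p%:R ^+ m :: t); last first.
  by rewrite big_cons E [in RHS]big_ord_recr /= addrA [D _ + _]addrC.
split; last by rewrite /= st.
have pm0 : 0 < p%:R ^+ m :> rat by rewrite exprn_gt0 //; lra.
have -> : z / p%:R ^+ m.+1 = z / p%:R / p%:R ^+ m by rewrite exprS invfM mulrA.
rewrite /= pt andbT /doubling; apply/andP; split.
  by rewrite !divr_gt0 //; lra.
rewrite [leRHS](_ : _ = p%:R * (z / p%:R / p%:R ^+ m)).
  by rewrite ler_wpM2r // !divr_ge0 //; lra.
by field; rewrite !gt_eqF //; lra.
Qed.

(* After the outer hook is removed, the array that remains is that of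
   [behead y / p] with [e - 1] in place of [e]. *)
Lemma sum_hooks_le (D : rat -> int) (W : int -> int) (p : nat) :
  (1 < p)%N -> (forall k, W (- k) = - W k) ->
  (forall z y, 0 < z -> path doubling z y -> \sum_(u <- z :: y) D u <= W (size y).+1%:Z) ->
  forall e z y, 0 < z -> path doubling z y ->
    \sum_(u <- z :: y) \sum_(i < e.+1) D (u / p%:R ^+ i) <= boxsum e W (size y).+1%:Z.
Proof.
move=> p1 WN DW; elim=> [|e IHe] z y z0 zy.
  rewrite /boxsum big_ord1 /= addr0 subr0.
  by under eq_bigr do rewrite big_ord1 expr0 divr1; exact: DW.
have [t [pt st] E] := hook D p e.+1 z y p1 z0 zy.
have pn0 : 0 < p%:R :> rat by rewrite ltr0n; lia.
rewrite big_cons.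
have -> : \sum_(u <- y) \sum_(i < e.+2) D (u / p%:R ^+ i)
   = \sum_(u <- y) D u + \sum_(u <- y) \sum_(i < e.+1) D (u / p%:R / p%:R ^+ i).
  rewrite -big_split; apply: eq_bigr => u _ /=.
  rewrite big_ord_recl expr0 divr1; congr (_ + _); apply: eq_bigr => i _.
  by rewrite exprS invfM mulrA.
(* The hook, a doubling path of [(size y).+1 + e.+1] endpoints, is charged to the term [i = 0]; the
   other terms form the box sum of [e] centred at [size y]. *)
rewrite addrA -E /boxsum big_ord_recl lerD //.
  have := DW _ _ (divr_gt0 z0 (exprn_gt0 e.+1 pn0)) pt.
  rewrite st; congr (_ <= W _); rewrite /=; lia.
have -> : \sum_(i < e.+1) W ((size y).+1%:Z + e.+1%:Z - (2 * lift ord0 i)%:Z)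
    = boxsum e W (size y)%:Z.
  by apply: eq_bigr => i _; congr (W _); rewrite /= /bump /=; lia.
(* If [y] is empty, nothing remains after the hook, and the remaining box sum, centred at 0,
   vanishes because [W] is odd. *)
case: y zy {t pt st E} => [_|z1 y /= /andP[/andP[_ zz1] z1y]].
  rewrite big_nil /=; have := smear_odd [:: e] W WN 0; rewrite /= oppr0.
  by move: (boxsum e W 0) => w; lia.
have z10 : 0 < z1 by lra.
have /IHe := divr_gt0 z10 pn0 => /(_ [seq u / p%:R | u <- y]).
rewrite size_map -(big_map (fun u => u / p%:R) xpredT
  (fun u => \sum_(i < e.+1) D (u / p%:R ^+ i))) /=; apply.
apply: (homo_path (f := fun u : rat => u / p%:R)) z1y => u v /andP[u0 uv].
by rewrite /= /doubling divr_gt0 //= mulrA ler_pM2r // invr_gt0.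
Qed.

Lemma dyadic_count_add_divisors (p e : nat) (ds : seq nat) (y : rat) :
  (0 < p)%N ->
  dyadic_count (PrimeDecompAux.add_divisors (p, e) ds) y
  = \sum_(i < e.+1) dyadic_count ds (y / p%:R ^+ i).
Proof.
move=> p0; rewrite /dyadic_count sum_add_divisors.
apply: eq_bigr => i _; apply: eq_bigr => d _.
have pi0 : 0 < p%:R ^+ i :> rat by rewrite exprn_gt0 // ltr0n.
by rewrite natrM natrX ler_pdivrMr // mulrA ltr_pdivlMr // ![d%:R * _]mulrC.
Qed.

(* [smear s sgz k] is the sum of the [k] largest rank numbers, the analogue of
   the Erdos-Kleitman bound for a union of [k] antichains; several intervals
   have to be treated at once for the induction on the primes to go through. *)
Lemma dyadic_count_le_smear (pd : seq (nat * nat)) (z : rat) (y : seq rat) :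
  all (fun pe => 1 < pe.1)%N pd -> 0 < z -> path doubling z y ->
  \sum_(u <- z :: y) dyadic_count (foldr PrimeDecompAux.add_divisors [:: 1%N] pd) u
  <= smear (map snd pd) (@sgz int) (size y).+1%:Z.
Proof.
elim: pd z y => [|[p e] pd IH] z y.
  (* Only the divisor 1 is left, and at most one of the disjoint intervals contains it. *)
  move=> _ _ zy; have -> : smear (map snd [::]) (@sgz int) (size y).+1%:Z = 1 by [].
  rewrite /dyadic_count; under eq_bigr do rewrite big_seq1.
  elim: y z zy => [|z1 y IHy] z; first by rewrite big_seq1; case: (_ && _).
  move=> /[dup] /(order_path_min doubling_trans) /allP zy /= /andP[_ /IHy {}IHy].
  rewrite big_cons; case: (boolP (_ && _)) => [/andP[_ z1']|_]; last by rewrite add0r.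
  rewrite big_seq big1 ?addr0 // => u /zy /andP[_ zu].
  by have -> : (u <= 1%:R) = false by apply/negbTE; rewrite -ltNge; lra.
move=> /andP[p1 pd1] z0 zy.
rewrite [foldr _ _ _]/=; under eq_bigr do rewrite dyadic_count_add_divisors ?(ltnW p1) //.
apply: sum_hooks_le => // [k|z' y' z'0 zy']; last exact: IH.
by apply: smear_odd; exact: sgzN.
Qed.

Lemma tau_prime_decomp (n : nat) :
  tau n = (\prod_(e <- map snd (prime_decomp n)) e.+1)%N.
Proof.
rewrite /tau -sum1_size /divisors big_map.
elim: (prime_decomp n) => [|[p e] pd IH] /=; first by rewrite big_seq1 big_nil.
by rewrite (sum_add_divisors nat) IH sum_nat_const card_ord big_cons.
Qed.

Lemma Omega2_prime_decomp (n : nat) :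
  Omega2 n = (\sum_(e <- map snd (prime_decomp n)) e ^ 2)%N.
Proof. by rewrite /Omega2 prime_decompE !big_map. Qed.

Lemma dyadic_count_divisors (n : nat) (y : rat) : 0 < y ->
  dyadic_count (divisors n) y ^+ 2 * (Omega2 n)%:Z <= 48 * (tau n)%:Z ^+ 2.
Proof.
move=> y0; rewrite tau_prime_decomp Omega2_prime_decomp.
apply: le_trans (smear_pulse_le _); rewrite ler_wpM2r // -smear_sgz1.
have := dyadic_count_le_smear (prime_decomp n) y [::]; rewrite big_seq1 => cnt.
have c0 : 0 <= dyadic_count (divisors n) y by apply: sumr_ge0.
have {}cnt : dyadic_count (divisors n) y <= smear (map snd (prime_decomp n)) (@sgz int) 1.
  by apply: cnt => //; apply/allP => -[p e] /mem_prime_decomp[/prime_gt1].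
by rewrite lerXn2r // nnegrE (le_trans c0).
Qed.

(** * The logarithm of the Vandermonde determinant *)

Lemma sum_divisors_inv (V : nmodType) (n : nat) (F : nat -> V) : (0 < n)%N ->
  \sum_(d <- divisors n) F (n %/ d)%N = \sum_(d <- divisors n) F d.
Proof.
move=> n0; rewrite -(big_map (fun d => n %/ d)%N xpredT F).
have divK d : (d %| n)%N -> (n %/ (n %/ d) = d)%N.
  by move=> dn; rewrite divnA ?mulKn.
have div_dvd d : (d %| n)%N -> (n %/ d %| n)%N.
  by move=> dn; apply/dvdnP; exists d; rewrite mulnC divnK.
apply: perm_big; apply: uniq_perm; last 1 first.
- move=> d; rewrite -dvdn_divisors //; apply/mapP/idP => [[d']|dn].
    by rewrite -dvdn_divisors // => d'n ->; exact: div_dvd.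
  by exists (n %/ d)%N; rewrite ?divK // -dvdn_divisors // div_dvd.
- rewrite map_inj_in_uniq ?divisors_uniq // => d d'.
  by rewrite -!dvdn_divisors // => dn d'n e; rewrite -(divK d) // e divK.
- exact: divisors_uniq.
Qed.

Lemma sum_sym (V : zmodType) (m : nat) (G : 'I_m -> 'I_m -> V) :
  (forall i j, G i j = G j i) -> (forall i, G i i = 0) ->
  \sum_(i < m) \sum_(j < m) G i j = (\sum_(j < m) \sum_(i < m | (i < j)%N) G i j) *+ 2.
Proof.
move=> Gsym G0; rewrite mulr2n.
have -> : \sum_(i < m) \sum_(j < m) G i j
   = \sum_(j < m) (\sum_(i < m | (i < j)%N) G i j + \sum_(i < m | (j < i)%N) G i j).
  rewrite exchange_big; apply: eq_bigr => j _ /=.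
  rewrite (bigID (fun i : 'I_m => (i < j)%N)) /=; congr (_ + _).
  rewrite (bigD1 j) ?ltnn //= G0 add0r; apply: eq_bigl => i.
  by rewrite -leqNgt ltn_neqAle andbC eq_sym.
rewrite big_split /=; congr (_ + _).
rewrite (exchange_big_dep xpredT) //=; apply: eq_bigr => j _.
by apply: eq_bigr => i _.
Qed.

(** Positivity is carried along because [lnM] needs it at each step, and it serves again for nested
    products. *)
Lemma ln_prod (R : realType) (I : Type) (r : seq I) (P : pred I) (F : I -> R) :
  (forall i, P i -> 0 < F i) ->
  0 < \prod_(i <- r | P i) F i /\
  ln (\prod_(i <- r | P i) F i) = \sum_(i <- r | P i) ln (F i).
Proof.
move=> F0; apply: (big_ind2 (fun u v => 0 < u /\ ln u = v)) => [|u ? v ?|i Pi].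
- by rewrite ln1.
- by move=> [u0 <-] [v0 <-]; rewrite mulr_gt0 // lnM.
- by rewrite F0.
Qed.

Section LogVandermonde.
Variables (R : realType) (n : nat).
Hypothesis n0 : (0 < n)%N.

Let D := divisors n.
Let x (d : nat) : R := ln d%:R.
Let L : R := ln n%:R.

Lemma ln_vandermonde :
  ln (vandermonde_divisors n)%:~R *+ 2
  = \sum_(d <- D) \sum_(d' <- D) ln `|d%:R - d'%:R| :> R.
Proof.
rewrite (big_nth 0%N) big_mkord; under [RHS]eq_bigr do rewrite (big_nth 0%N) big_mkord.
(* Diagonal terms vanish because [ln 0] is 0 by convention. *)
rewrite sum_sym => [|i j|i]; [|by rewrite distrC|by rewrite subrr normr0 ln0].
congr (_ *+ 2).
have lt_nth (i j : 'I_(tau n)) : (i < j)%N -> (nth 0 D i < nth 0 D j)%N.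
  by move=> ij; rewrite (sorted_ltn_nth ltn_trans) ?inE // sorted_divisors_ltn.
rewrite rmorph_prod /=.
have pos (i j : 'I_(tau n)) : (i < j)%N ->
    0 < ((nth 0%N D j)%:Z - (nth 0%N D i)%:Z)%:~R :> R.
  by move=> /lt_nth ij; rewrite ltr0z subr_gt0 ltz_nat.
rewrite (ln_prod _ _ _ _ _ _).2 => [|j _]; last first.
  by rewrite rmorph_prod /= (ln_prod _ _ _ _ _ _).1 // => i; exact: pos.
apply: eq_bigr => j _; rewrite rmorph_prod /= (ln_prod _ _ _ _ _ _).2 => [|i]; last exact: pos.
apply: eq_bigr => i ij; congr ln.
by rewrite distrC rmorphB /= ger0_norm // subr_ge0 ler_nat ltnW // lt_nth.
Qed.

Lemma divisor_ge1 d : d \in D -> 1 <= d%:R :> R.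
Proof. by rewrite -dvdn_divisors // (ler_nat _ 1) => /dvdn_gt0; apply. Qed.

Lemma ln_divisor d : d \in D -> 0 <= x d <= L.
Proof.
move=> dD; rewrite ln_ge0 ?divisor_ge1 //=.
have := divisor_ge1 _ dD => d1; rewrite ler_ln ?posrE.
- by rewrite ler_nat dvdn_leq // dvdn_divisors.
- by lra.
- by rewrite ltr0n.
Qed.

Lemma ln_div_divisor d : d \in D -> x (n %/ d) = L - x d.
Proof.
move=> dD; have := divisor_ge1 _ dD => d1.
rewrite /x /L -ln_div ?posrE ?ltr0n // -?(ltr_nat R); last by lra.
by rewrite natf_div // dvdn_divisors.
Qed.

Lemma sum_ln_divisors : \sum_(d <- D) x d = (tau n)%:R * L / 2.
Proof.
have : \sum_(d <- D) x d = \sum_(d <- D) (L - x d).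
  rewrite -[LHS](sum_divisors_inv _ _ _ n0) big_seq [RHS]big_seq.
  by apply: eq_bigr => d; exact: ln_div_divisor.
rewrite sumrB big_const_seq count_predT -/(tau n) iter_addr_0 -mulr_natl; lra.
Qed.

(** * Upper bound for log V(n) *)

Lemma ln_vandermonde_le : ln (vandermonde_divisors n)%:~R <= 3 * (tau n)%:R ^+ 2 / 8 * L.
Proof.
pose t : R := (tau n)%:R.
have sumC (c : R) : \sum_(d <- D) c = t * c.
  by rewrite big_const_seq count_predT -/(tau n) iter_addr_0 mulr_natl.
have absdev d : d \in D -> \sum_(d' <- D) `|x d - x d'| <= t * L / 2.
  move=> dD; have -> : t * L / 2 = 2^-1 * \sum_(d' <- D) L by rewrite sumC; lra.
  have -> : \sum_(d' <- D) `|x d - x d'|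
      = 2^-1 * \sum_(d' <- D) (`|x d - x d'| + `|x d - (L - x d')|).
    rewrite big_split /=.
    have <- : \sum_(d' <- D) `|x d - x d'| = \sum_(d' <- D) `|x d - (L - x d')|.
      rewrite -[LHS](sum_divisors_inv _ _ _ n0) big_seq [RHS]big_seq.
      by apply: eq_bigr => d' /ln_div_divisor ->.
    lra.
  rewrite ler_pM2l // big_seq [leRHS]big_seq; apply: ler_sum => d' /ln_divisor.
  have := ln_divisor _ dD; move: (x d) (x d') => u v /andP[? ?] /andP[? ?].
  by case: (ler0P (u - v)) => ?; case: (ler0P (u - (L - v))) => ?; lra.
have pt d d' : d \in D -> d' \in D ->
    ln `|d%:R - d'%:R| <= (x d + x d' + `|x d - x d'|) / 2.
  wlog dd' : d d' / (d <= d')%N.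
    move=> H; have [/H //|/ltnW /H {}H dD d'D] := leqP d d'.
    by rewrite distrC [`|x _ - _|]distrC [x d + _]addrC H.
  move=> dD d'D; have := divisor_ge1 _ dD; have := divisor_ge1 _ d'D => d1 d'1.
  have ler : x d <= x d' by rewrite ler_ln ?posrE ?ler_nat //; lra.
  have ddr : d%:R <= d'%:R :> R by rewrite ler_nat.
  rewrite [`|x d - _|]distrC [`|x d' - _|]ger0_norm ?subr_ge0 //.
  have -> : (x d + x d' + (x d' - x d)) / 2 = x d' by lra.
  have [e|ne] := eqVneq (d%:R : R) d'%:R.
    by rewrite e subrr normr0 ln0 //; case/andP: (ln_divisor _ d'D).
  rewrite distrC ger0_norm ?subr_ge0 // ler_ln ?posrE; lra.
suff : \sum_(d <- D) \sum_(d' <- D) ln `|d%:R - d'%:R| <= 3 / 4 * t ^+ 2 * L.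
  by rewrite -ln_vandermonde mulr2n -/t; lra.
(* For fixed [d], the three terms come from [x d], from the mean L/2 of the [x d'], and from
   [absdev]. *)
have -> : 3 / 4 * t ^+ 2 * L = \sum_(d <- D) (t * x d + t * L / 2 + t * L / 2) / 2.
  by rewrite -mulr_suml !big_split -!mulr_sumr /= !sumC sum_ln_divisors -/t; field.
rewrite big_seq [leRHS]big_seq; apply: ler_sum => d dD.
apply: le_trans (_ : \sum_(d' <- D) (x d + x d' + `|x d - x d'|) / 2 <= _).
  by rewrite big_seq [leRHS]big_seq; apply: ler_sum => d' d'D; exact: pt.
rewrite -mulr_suml !big_split /= sumC sum_ln_divisors -/t ler_pM2r //.
by rewrite lerD2l absdev.
Qed.

(** * Lower bound for log V(n) *)

Lemma near_divisors_le d : d \in D -> (0 < Omega2 n)%N ->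
  \sum_(d' <- D) ((d <= d') && (d' < 2 * d) : nat)%N%:R
  <= 7 * (tau n)%:R / Num.sqrt (Omega2 n)%:R :> R.
Proof.
move=> dD Om0; have d0 : (0 < d)%N by have := divisor_ge1 _ dD; rewrite (ler_nat _ 1).
have := dyadic_count_divisors n d%:R; rewrite ltr0n => /(_ d0).
have -> : dyadic_count (divisors n) d%:R
    = (\sum_(d' <- D) ((d <= d') && (d' < 2 * d)))%N%:Z.
  rewrite /dyadic_count (rmorph_sum Posz) /=; apply: eq_bigr => d' _.
  by rewrite ler_nat -natrM ltr_nat.
rewrite -natr_sum; move: (\sum_(d' <- D) _)%N => c.
move=> H; have : (c ^ 2 * Omega2 n <= 48 * tau n ^ 2)%N by lia.
rewrite -(ler_nat R) !natrM => {}H.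
have s0 : 0 < Num.sqrt (Omega2 n)%:R :> R by rewrite sqrtr_gt0 ltr0n.
rewrite ler_pdivlMr // -ler_sqr ?nnegrE ?mulr_ge0 ?(ltW s0) //.
(* The 7 comes from 48 <= 7^2. *)
by rewrite !exprMn sqr_sqrtr //; have := sqr_ge0 ((tau n)%:R : R); lra.
Qed.

Lemma ln_vandermonde_ge : (2 <= n)%N ->
  (tau n)%:R ^+ 2 / 4 * L * (1 - 28 * (L^-1 + (Num.sqrt (Omega2 n)%:R)^-1))
  <= ln (vandermonde_divisors n)%:~R.
Proof.
move=> n2.
have Om0 : (0 < Omega2 n)%N.
  rewrite /Omega2 (bigD1_seq (pdiv n)) ?primes_uniq ?mem_primes ?pdiv_prime ?n0 ?pdiv_dvd //=.
  by rewrite addn_gt0 expn_gt0 logn_gt0 mem_primes pdiv_prime ?n0 ?pdiv_dvd.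
have L0 : 0 < L by rewrite ln_gt0 // (ltr_nat _ 1).
pose t : R := (tau n)%:R; pose q : R := (Num.sqrt (Omega2 n)%:R)^-1.
have q0 : 0 < q by rewrite invr_gt0 sqrtr_gt0 ltr0n.
have sumC (c : R) : \sum_(d <- D) c = t * c.
  by rewrite big_const_seq count_predT -/(tau n) iter_addr_0 mulr_natl.
(* One-sided, to match the interval [d, 2d); adding both orders covers every pair within a factor
   2. *)
pose near (d d' : nat) : R := ((d <= d') && (d' < 2 * d) : nat)%N%:R.
have pt d d' : d \in D -> d' \in D ->
    (x d + x d') / 2 - ln 2 - L * (near d d' + near d' d) <= ln `|d%:R - d'%:R|.
  wlog dd' : d d' / (d <= d')%N.
    move=> H; have [/H //|/ltnW /H {}H dD d'D] := leqP d d'.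
    by rewrite distrC [near d _ + _]addrC [x d + _]addrC H.
  move=> dD d'D; have := divisor_ge1 _ dD; have := divisor_ge1 _ d'D => d1 d'1.
  have /andP[xd xdL] := ln_divisor _ dD; have /andP[xd' xd'L] := ln_divisor _ d'D.
  have ln2 : 0 <= ln 2 :> R by rewrite ln_ge0 // (ler_nat _ 1).
  have n1 : 0 <= near d' d by rewrite ler0n.
  have Ln1 := mulr_ge0 (ltW L0) n1.
  have [d'd|d'd] := ltnP d' (2 * d)%N.
    rewrite {1}/near dd' d'd /=.
    suff : 0 <= ln `|d%:R - d'%:R| :> R by rewrite mulrDr mulr1; lra.
    have [->|ne] := eqVneq d d'; first by rewrite subrr normr0 ln0.
    rewrite ln_ge0 // distrC ger0_norm ?subr_ge0 ?ler_nat // -natrB //.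
    by rewrite (ler_nat _ 1) subn_gt0 ltn_neqAle ne.
  rewrite {1}/near ltnNge d'd andbF /=.
  have dr : 2 * d%:R <= d'%:R :> R by rewrite -natrM ler_nat.
  have ler : x d <= x d' by rewrite ler_ln ?posrE ?ler_nat //; lra.
  (* Here d' - d >= d'/2, and log d' is at least the mean of log d and log d'. *)
  apply: le_trans (_ : x d' - ln 2 <= _); first by rewrite mulrDr mulr0; lra.
  rewrite distrC ger0_norm; last by lra.
  by rewrite -ln_div ?posrE ?ler_ln ?posrE; lra.
have nearE : \sum_(d <- D) \sum_(d' <- D) near d d' <= 7 * t ^+ 2 * q.
  have -> : 7 * t ^+ 2 * q = \sum_(d <- D) (7 * t * q) by rewrite sumC; ring.
  rewrite big_seq [leRHS]big_seq; apply: ler_sum => d dD.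
  exact: near_divisors_le.
have : \sum_(d <- D) \sum_(d' <- D)
      ((x d + x d') / 2 - ln 2 - L * (near d d' + near d' d))
    <= \sum_(d <- D) \sum_(d' <- D) ln `|d%:R - d'%:R|.
  rewrite big_seq [leRHS]big_seq; apply: ler_sum => d dD.
  by rewrite big_seq [leRHS]big_seq; apply: ler_sum => d' d'D; exact: pt.
rewrite -ln_vandermonde.
have -> : \sum_(d <- D) \sum_(d' <- D)
      ((x d + x d') / 2 - ln 2 - L * (near d d' + near d' d))
   = t ^+ 2 * L / 2 - t ^+ 2 * ln 2
     - 2 * L * \sum_(d <- D) \sum_(d' <- D) near d d'.
  have E d : \sum_(d' <- D) ((x d + x d') / 2 - ln 2 - L * (near d d' + near d' d))
    = t * x d / 2 + t * L / 4 - t * ln 2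
      - L * (\sum_(d' <- D) near d d' + \sum_(d' <- D) near d' d).
    rewrite !sumrB -mulr_suml -mulr_sumr !big_split /= !sumC sum_ln_divisors -/t.
    by field.
  under eq_bigr do rewrite E.
  rewrite !sumrB big_split /= !sumC -mulr_suml -!mulr_sumr sum_ln_divisors big_split /=.
  rewrite [X in _ - L * (_ + X)]exchange_big /= -/t.
  by field.
have ln2 : ln 2 <= 2 :> R by apply: ltW; apply: ln_sublinear.
set S := \sum_(d <- D) _ in nearE *.
move=> H.
(* The 28 is 4 times the constant 7 for near pairs, because of the factor 1/4 in front. The
   resulting [7 * t ^+ 2] also absorbs the loss from [ln 2], at most [t ^+ 2] after halving. *)
have -> : (tau n)%:R ^+ 2 / 4 * L * (1 - 28 * (L^-1 + (Num.sqrt (Omega2 n)%:R)^-1))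
   = t ^+ 2 * L / 4 - 7 * t ^+ 2 - 7 * t ^+ 2 * L * q.
  by rewrite -/t -/q; field; rewrite gt_eqF.
have : L * S <= L * (7 * t ^+ 2 * q) by rewrite ler_pM2l.
have : t ^+ 2 * ln 2 <= t ^+ 2 * 2 by rewrite ler_wpM2l // sqr_ge0.
have := sqr_ge0 t.
move: H; rewrite [ln _ *+ 2]mulr2n; lra.
Qed.

End LogVandermonde.

Theorem theorem1 (R : realType) :
  (exists2 C : R, 0 < C &
     forall n : nat, (2 <= n)%N ->
       (tau n)%:R ^+ 2 / 4 * ln (n%:R : R)
         * (1 - C * ((ln (n%:R : R))^-1 + (Num.sqrt ((Omega2 n)%:R : R))^-1))
       <= ln ((vandermonde_divisors n)%:~R : R))
  /\
  (forall n : nat, (2 <= n)%N ->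
     ln ((vandermonde_divisors n)%:~R : R)
       <= 3 * (tau n)%:R ^+ 2 / 8 * ln (n%:R : R)).
Proof.
split; first by exists 28 => // n n2; apply: ln_vandermonde_ge => //; exact: ltnW.
by move=> n n2; apply: ln_vandermonde_le; exact: ltnW.
Qed.
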